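(* For $\mu>0$ and $v_0\in\mathbb{R}^m$, let $v_{i+1} = v_i+d(v_i,\mu)$ for $i = 0,1,2,\ldots$. If $h_\mu(v_0)\le\theta\le\frac12$, then $h_\mu(v_i)\le\theta^{2^i}$ for all $i$.
   Context: Data and standing assumptions: $A\in\mathbb{R}^{m\times n}$, $b\in\mathbb{R}^m$, $c\in\mathbb{R}^n$, and $W\in\mathbb{R}^{n\times n}$ is symmetric positive semidefinite. It is assumed that (i) there exists $x\in\mathbb{R}^n$ with $Ax+b>0$ (componentwise); (ii) for every $\gamma\in\mathbb{R}$ the set $\{x\in\mathbb{R}^n: \frac12 x^TWx + c^Tx\le\gamma,\ Ax+b\ge0\}$ is bounded; (iii) $A^TA+W$ is positive definite. Notation: $\circ$ is the elementwise product, $e^v$ is the elementwise exponential. Centered point: for $\mu>0$, $\hat v(\mu)$ is the unique $v\in\mathbb{R}^m$ such that, for some $x\in\mathbb{R}^n$, $\sqrt\mu A^Te^v = Wx+c$ and $\sqrt\mu e^{-v} = Ax+b$. (It exists and is unique under the standing assumptions.) Newton direction: for $v\in\mathbb{R}^m$ and $\mu>0$, $d(v,\mu)\in\mathbb{R}^m$ is the (unique) $d$ that, together with a (unique) $x\in\mathbb{R}^n$, satisfies $\sqrt\mu A^T(e^v+e^v\circ d) = Wx+c$ and $\sqrt\mu(e^{-v}-e^{-v}\circ d) = Ax+b$. Divergence: $h(u,v) := \langle e^u,e^{-v}\rangle+\langle e^{-u},e^v\rangle-2m$ for $u,v\in\mathbb{R}^m$, and $h_\mu(v) := h(\hat v(\mu),v)$.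 *)

(* Defs.v *)
From mathcomp Require Import all_boot all_order all_algebra.
From mathcomp Require Import all_classical all_reals all_analysis.

Set Implicit Arguments.
Unset Strict Implicit.
Unset Printing Implicit Defensive.

Import Order.TTheory GRing.Theory Num.Theory.
Import numFieldNormedType.Exports.

Local Open Scope classical_set_scope.
Local Open Scope ring_scope.

Section Definitions.
Variable R : realType.

Definition dotv n (u v : 'cV[R]_n) : R := (u^T *m v) 0 0.

Definition hadamard n (u v : 'cV[R]_n) : 'cV[R]_n := map2_mx *%R u v.

Definition vexp n (v : 'cV[R]_n) : 'cV[R]_n := map_mx expR v.

Definition pos_semidefinite n (M : 'M[R]_n) : Prop :=
  M^T = M /\ forall x : 'cV[R]_n, 0 <= dotv x (M *m x).

Definition pos_definite n (M : 'M[R]_n) : Prop :=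
  M^T = M /\ forall x : 'cV[R]_n, x != 0 -> 0 < dotv x (M *m x).

Section QuadraticProgram.
Variables (m n : nat) (A : 'M[R]_(m, n)) (b : 'cV[R]_m) (c : 'cV[R]_n)
  (W : 'M[R]_n).

Definition strictly_feasible (x : 'cV[R]_n) : Prop :=
  forall i, 0 < (A *m x + b) i 0.

Definition sublevel (gamma : R) : set 'cV[R]_n :=
  [set x | 2^-1 * dotv x (W *m x) + dotv c x <= gamma /\
           forall i, 0 <= (A *m x + b) i 0].

Definition is_centered (mu : R) (v : 'cV[R]_m) : Prop :=
  exists x : 'cV[R]_n,
    Num.sqrt mu *: (A^T *m vexp v) = W *m x + c /\
    Num.sqrt mu *: vexp (- v) = A *m x + b.

(* [get P] is some point of [P] when [P] is nonempty and an arbitrary default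
   otherwise; under the standing assumptions both sets below are singletons,
   so that it acts as a definite description. *)
Definition centered_point (mu : R) : 'cV[R]_m := get [set v | is_centered mu v].

Definition is_newton_direction (v : 'cV[R]_m) (mu : R) (d : 'cV[R]_m) : Prop :=
  exists x : 'cV[R]_n,
    Num.sqrt mu *: (A^T *m (vexp v + hadamard (vexp v) d)) = W *m x + c /\
    Num.sqrt mu *: (vexp (- v) - hadamard (vexp (- v)) d) = A *m x + b.

Definition newton_direction (v : 'cV[R]_m) (mu : R) : 'cV[R]_m :=
  get [set d | is_newton_direction v mu d].

End QuadraticProgram.

Definition divergence m (u v : 'cV[R]_m) : R :=
  dotv (vexp u) (vexp (- v)) + dotv (vexp (- u)) (vexp v) - 2 * m%:R.

Definition centered_divergence m n (A : 'M[R]_(m, n)) (b : 'cV[R]_m)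
    (c : 'cV[R]_n) (W : 'M[R]_n) (mu : R) (v : 'cV[R]_m) : R :=
  divergence (centered_point A b c W mu) v.

End Definitions.

(* Main.v *)
Require Import Defs.
From mathcomp Require Import all_boot all_order all_algebra.
From mathcomp Require Import all_classical all_reals all_analysis.
From mathcomp Require Import ring lra.
Import Order.TTheory GRing.Theory Num.Theory.
Import numFieldNormedType.Exports.
Local Open Scope classical_set_scope.
Local Open Scope ring_scope.

(** Write [u] for the centered point, [s = v - u], and [g_i = 2 (cosh s_i - 1)],
    so that [h_mu(v) = sum g_i].  Subtracting the centrality equations from the
    Newton equations and using [W >= 0] gives
    [sum (d_i^2 + 2 d_i sinh s_i + g_i) <= 0], that is,
    [sum (d_i + sinh s_i)^2 <= sum g_i^2 / 4].  The new offset
    [s_i + d_i = (d_i + sinh s_i) + (s_i - sinh s_i)] is thus the sum of a term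
    that is quadratically small in [l^2] and of a cubic remainder, which yields
    [h_mu(v + d) <= h_mu(v)^2].

    [centered_point] and [newton_direction] are choices, so both need an
    existence proof.  The Newton system reduces to the invertibility of
    [W + A^T diag(e^{2v}) A].  A centered point comes from a minimizer of the
    log barrier [x^T W x / 2 + c^T x - mu sum ln (A x + b)_i]: bounded sublevel
    sets and convexity make the quadratic part grow linearly on the feasible
    set, which beats the logarithms. *)

(** * Scalar estimates for sinh and cosh near zero *)

Section HyperbolicEstimates.
Context {R : realType}.
Implicit Types s y a : R.

Lemma sub_sinh_le_pos s : 0 <= s -> expR s + expR (- s) <= 5 / 2 ->
  `|s - (expR s - expR (- s)) / 2| <= (expR s + expR (- s) - 2) / 3.
Proof.
(* With [a = e^(s/2)] in [[1, sqrt 2]], [expR_ge1Dx] at [s/2] and [-s/2] gives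
   [2 (1 - 1/a) <= s <= 2 (a - 1)], and both bounds reduce to a sign of
   [(a - 1)^2] times a quadratic in [a]. *)
move=> s0 hs; set a := expR (s / 2).
have a1 : 1 <= a by rewrite /a -[leLHS]expR0 ler_expR divr_ge0.
have a0 : 0 < a by apply: lt_le_trans a1.
have va : expR (- (s / 2)) = a^-1 by rewrite expRN.
have es : expR s = a ^+ 2.
  by rewrite /a -expRM_natl; congr expR; field.
have eNs : expR (- s) = a^-1 ^+ 2 by rewrite expRN es exprVn.
have lo : s / 2 >= 1 - a^-1.
  by have := expR_ge1Dx (- (s / 2)); rewrite va; lra.
have up : s / 2 <= a - 1 by have := expR_ge1Dx (s / 2); rewrite -/a; lra.
rewrite es eNs in hs *.
have ai : a * a^-1 = 1 by rewrite divff// gt_eqF.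
set w := a^-1 in va lo hs ai *.
have w0 : 0 < w by rewrite invr_gt0.
have w1 : w <= 1 by rewrite invf_le1.
(* Multiplied by [2 * a ^+ 2], the hypothesis factors as [(a ^+ 2 - 2) * (2 * a ^+ 2 - 1) <= 0], and
   the second factor is positive since [1 <= a]. *)
have a2 : a ^+ 2 <= 2.
  have : (a ^+ 2 - 2) * (2 * a ^+ 2 - 1) <= 0.
    have -> : (a ^+ 2 - 2) * (2 * a ^+ 2 - 1) =
      2 * a ^+ 2 * (a ^+ 2 + w ^+ 2 - 5 / 2).
      have -> : (2 * a ^+ 2 * (a ^+ 2 + w ^+ 2 - 5 / 2) =
        2 * (a^+ 4 + (a * w) ^+2) - 5 * a ^+2) by field.
      by rewrite ai; ring.
    by apply: mulr_ge0_le0; [nra | lra].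
  have a21 : 1 <= a ^+ 2 by rewrite expr_ge1 // ltW.
  rewrite pmulr_lle0; lra.
(* [10 / 7] lies between sqrt 2 and sqrt 6 - 1, the positive root of [a ^+ 2 + 2 * a - 5], so that
   this factor is negative below. *)
have a32 : a <= 10 / 7 by nra.
rewrite ler_norml; apply/andP; split.
- have : (a - 1) ^+ 2 * (a ^+ 2 + 2 * a - 5) * w ^+ 2 <= 0.
    by apply: mulr_le0_ge0; [apply: mulr_ge0_le0|]; rewrite ?sqr_ge0//; nra.
  have -> : (a - 1) ^+ 2 * (a ^+ 2 + 2 * a - 5) * w ^+ 2 =
    a ^+ 2 * (a * w) ^+ 2 - 8 * (a * w) ^+ 2 + 12 * (a * w) * w
    - 5 * w ^+ 2 by ring.
  by rewrite ai; lra.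
- have : 0 <= (a - 1) ^+ 2 * (5 * a ^+ 2 - 2 * a - 1) * w ^+ 2.
    by apply: mulr_ge0; [apply: mulr_ge0|]; rewrite ?sqr_ge0//; nra.
  have -> : (a - 1) ^+ 2 * (5 * a ^+ 2 - 2 * a - 1) * w ^+ 2 =
    5 * a ^+ 2 * (a * w) ^+ 2 - 12 * a * (a * w) ^+ 2 + 8 * (a * w) ^+ 2
    - w ^+ 2 by ring.
  by rewrite ai; lra.
Qed.

Lemma sub_sinh_le s : expR s + expR (- s) <= 5 / 2 ->
  `|s - (expR s - expR (- s)) / 2| <= (expR s + expR (- s) - 2) / 3.
Proof.
have [s0|s0] := leP 0 s; first exact: sub_sinh_le_pos.
rewrite addrC => hs.
have := @sub_sinh_le_pos (- s); rewrite opprK oppr_ge0 (ltW s0) => /(_ isT hs).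
rewrite -normrN [expR s + _]addrC; congr (`|_| <= _); lra.
Qed.

(** The left side is [(a - w) ^+ 2] with [a = e^(y/2)] and [w = 1/a]. From [w >= 1 - y/2 >= 19/24]
    follow [a <= 24/19], then [a <= 1 + a y/2 <= 1 + 12 y/19], and so
    [a - w <= (12/19 + 1/2) y = 43 y/38], whose square is at most [13 y^2/10]. *)
Lemma cosh_sub1_le_pos y : 0 <= y -> y <= 5 / 12 ->
  expR y + expR (- y) - 2 <= 13 / 10 * y ^+ 2.
Proof.
move=> y0 y1; set a := expR (y / 2); set w := expR (- (y / 2)).
have aw : a * w = 1 by rewrite /a /w -expRD subrr expR0.
have ea : expR y = a ^+ 2 by rewrite /a -expRM_natl; congr expR; field.
have ew : expR (- y) = w ^+ 2 by rewrite /w -expRM_natl; congr expR; field.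
have hw : 1 - y / 2 <= w by have := expR_ge1Dx (- (y / 2)); rewrite -/w; lra.
have a0 : 0 < a by exact: expR_gt0.
have w0 : 0 < w by exact: expR_gt0.
have wa : w <= a by rewrite ler_expR; lra.
have -> : expR y + expR (- y) - 2 = (a - w) ^+ 2.
  rewrite ea ew; have -> : (a - w) ^+ 2 = a ^+ 2 + w ^+ 2 - 2 * (a * w) by ring.
  by rewrite aw mulr1.
have a1 : a * (1 - y / 2) <= 1 by rewrite -[leRHS]aw ler_pM2l.
have h19 : a * (19 / 24) <= 1 by nra.
have : a - w <= 43 / 38 * y.
  nra.
nra.
Qed.

Lemma cosh_sub1_le y : `|y| <= 5 / 12 ->
  expR y + expR (- y) - 2 <= 13 / 10 * y ^+ 2.
Proof.
have [y0|y0] := leP 0 y; first by rewrite ger0_norm//; exact: cosh_sub1_le_pos.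
rewrite ltr0_norm// => h; have := @cosh_sub1_le_pos (- y).
by rewrite opprK sqrrN [expR (- y) + _]addrC oppr_ge0 (ltW y0); exact.
Qed.

Lemma cosh_sub1_ge0 s : 0 <= expR s + expR (- s) - 2.
Proof.
have e0 := expR_gt0 s.
have -> : expR s + expR (- s) - 2 = (expR s - 1) ^+ 2 / expR s.
  by rewrite expRN; field; rewrite gt_eqF.
by rewrite divr_ge0 ?sqr_ge0 ?ltW.
Qed.

End HyperbolicEstimates.

(** * Contraction of one Newton step, in coordinates *)

Lemma ler_term_sum {R : realDomainType} {I : finType} (f : I -> R) (i : I) :
  (forall j, 0 <= f j) -> f i <= \sum_j f j.
Proof. by move=> f0; rewrite (bigD1 i)//= lerDl sumr_ge0. Qed.

Lemma sum_sqr_le {R : realDomainType} {I : finType} (f : I -> R) :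
  (forall j, 0 <= f j) -> \sum_j f j ^+ 2 <= (\sum_j f j) ^+ 2.
Proof.
move=> f0; rewrite [leRHS]expr2 mulr_suml; apply: ler_sum => i _.
by rewrite expr2 ler_wpM2l// ler_term_sum.
Qed.

Lemma newton_step_contraction {R : realType} {I : finType} (s d : I -> R)
    (H := \sum_i (expR (s i) + expR (- s i) - 2)) :
  \sum_i (d i ^+ 2 + d i * (expR (s i) - expR (- s i))
          + (expR (s i) + expR (- s i) - 2)) <= 0 ->
  H <= 2^-1 ->
  \sum_i (expR (s i + d i) + expR (- (s i + d i)) - 2) <= H ^+ 2.
Proof.
move=> hd hH; pose g i := expR (s i) + expR (- s i) - 2.
have g0 i : 0 <= g i by exact: cosh_sub1_ge0.
have gH i : g i <= H by rewrite /H (ler_term_sum g).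
(* [e = d + sinh s] and [g = 2 (cosh s - 1)], so
   [e^2 = d^2 + 2 d sinh s + g + g^2 / 4]. *)
pose e i := d i + (expR (s i) - expR (- s i)) / 2.
have e2 i : e i ^+ 2 = d i ^+ 2 + d i * (expR (s i) - expR (- s i)) + g i
    + g i ^+ 2 / 4.
  have pq : expR (s i) * expR (- s i) = 1 by rewrite -expRD subrr expR0.
  rewrite /e /g.
  set p := expR _ in pq *; set q := expR _ in pq *.
  transitivity (d i ^+ 2 + d i * (p - q) + (p + q - 2) + (p + q - 2) ^+ 2 / 4
    - (p * q - 1)); first by field.
  by rewrite pq subrr subr0.
have g2H : \sum_i g i ^+ 2 <= H ^+ 2 by exact: sum_sqr_le.
have e2H : \sum_i e i ^+ 2 <= H ^+ 2 / 4.
  under eq_bigr do rewrite e2.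
  rewrite big_split/= -mulr_suml.
  rewrite -[leRHS]add0r lerD// ler_wpM2r//.
have H0 : 0 <= H by apply: sumr_ge0 => i _; exact: g0.
have eH i : `|e i| <= 4^-1.
  rewrite -(@ler_pXn2r _ 2)// ?nnegrE// real_normK ?num_real//.
  apply: (le_trans (ler_term_sum (fun j => e j ^+ 2) i (fun j => sqr_ge0 _))).
  apply: (le_trans e2H). nra.
pose r i := s i - (expR (s i) - expR (- s i)) / 2.
(* [g i <= H <= 1/2] puts [s i] in the range of [sub_sinh_le]. *)
have rg i : `|r i| <= g i / 3.
  by apply: sub_sinh_le; have := gH i; rewrite /g; lra.
have yE i : s i + d i = e i + r i by rewrite /e /r; ring.
(* [|e i + r i| <= 1/4 + 1/6 = 5/12], exactly the range of [cosh_sub1_le]; then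
   [(e + r)^2 <= 2 (e^2 + r^2)]. *)
have key i : expR (s i + d i) + expR (- (s i + d i)) - 2 <=
    13 / 5 * (e i ^+ 2 + g i ^+ 2 / 9).
  rewrite yE; apply: (le_trans (cosh_sub1_le _ _)).
    by rewrite (le_trans (ler_normD _ _))//; have := eH i; have := rg i;
      have := gH i; lra.
  have : r i ^+ 2 <= (g i / 3) ^+ 2.
    by rewrite -[leLHS]real_normK ?num_real// ler_pXn2r ?nnegrE ?divr_ge0.
  have := sqr_ge0 (e i - r i); nra.
(* Summing leaves [H ^+ 2] with the factor [13/5 (1/4 + 1/9) = 169/180 < 1]. *)
apply: (le_trans (ler_sum _ (fun i _ => key i))).
rewrite -mulr_sumr big_split/= -mulr_suml; nra.
Qed.

(** * Inner products and the divergence as coordinate sums *)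

Section Dotv.
Context {R : realType}.

Lemma dotvE {n} (u v : 'cV[R]_n) : dotv u v = \sum_i u i 0 * v i 0.
Proof. by rewrite /dotv mxE; apply: eq_bigr => i _; rewrite mxE. Qed.

Lemma dotvC {n} (u v : 'cV[R]_n) : dotv u v = dotv v u.
Proof. by rewrite !dotvE; apply: eq_bigr => i _; rewrite mulrC. Qed.

Lemma dotvDr {n} (u v w : 'cV[R]_n) : dotv u (v + w) = dotv u v + dotv u w.
Proof. by rewrite /dotv mulmxDr mxE. Qed.

Lemma dotvDl {n} (u v w : 'cV[R]_n) : dotv (v + w) u = dotv v u + dotv w u.
Proof. by rewrite dotvC dotvDr !(dotvC u). Qed.

Lemma dotvZr {n} (a : R) (u v : 'cV[R]_n) : dotv u (a *: v) = a * dotv u v.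
Proof. by rewrite /dotv -scalemxAr mxE. Qed.

Lemma dotvZl {n} (a : R) (u v : 'cV[R]_n) : dotv (a *: u) v = a * dotv u v.
Proof. by rewrite dotvC dotvZr dotvC. Qed.

Lemma dotv_trmx {m n} (A : 'M[R]_(m, n)) x y :
  dotv x (A^T *m y) = dotv (A *m x) y.
Proof. by rewrite /dotv mulmxA trmx_mul. Qed.

Lemma dotvv_ge0 {n} (u : 'cV[R]_n) : 0 <= dotv u u.
Proof. by rewrite dotvE sumr_ge0 // => i _; rewrite -expr2 sqr_ge0. Qed.

Lemma dotvv_eq0 {n} (u : 'cV[R]_n) : dotv u u = 0 -> u = 0.
Proof.
rewrite dotvE => /eqP; rewrite psumr_eq0; last first.
  by move=> i _; rewrite -expr2 sqr_ge0.
move=> /allP h; apply/colP => i; rewrite mxE.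
by have /(_ (mem_index_enum i)) /= := h i; rewrite mulf_eq0 orbb => /eqP.
Qed.

Lemma unitmx_inj {n} (M : 'M[R]_n) :
  (forall x : 'cV[R]_n, M *m x = 0 -> x = 0) -> M \in unitmx.
Proof.
move=> inj; rewrite unitmxE unitfE -det_tr.
apply/det0P => -[x x0 /(congr1 trmx)].
rewrite trmx_mul trmxK trmx0 => /inj /(congr1 trmx); rewrite trmxK trmx0 => xE.
by rewrite xE eqxx in x0.
Qed.

Lemma divergenceE {m} (u v : 'cV[R]_m) : divergence u v =
  \sum_i (expR (v i 0 - u i 0) + expR (- (v i 0 - u i 0)) - 2).
Proof.
rewrite /divergence !dotvE !big_split/= sumr_const card_ord mulNrn mulr_natr.
rewrite [X in X - _]addrC.
congr (_ + _ - _); apply: eq_bigr => i _;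
  by rewrite !mxE -expRD; congr expR; ring.
Qed.

Lemma divergence_ge0 {m} (u v : 'cV[R]_m) : 0 <= divergence u v.
Proof. by rewrite divergenceE sumr_ge0 // => i _; exact: cosh_sub1_ge0. Qed.

End Dotv.

(** * The Newton direction: existence and one-step decrease *)

Section Newton.
Context {R : realType} {m n : nat} (A : 'M[R]_(m, n)) (b : 'cV[R]_m)
  (c : 'cV[R]_n) (W : 'M[R]_n).
Hypothesis W_psd : pos_semidefinite W.

(** The second Newton equation gives [d] in terms of [x]; substituted into the first, it leaves a
    linear system with matrix [W + A^T E A], [E = diag(e^(2v))]. On its kernel [x^T W x] and
    [|e^v o A x|^2] sum to zero, so both vanish, and [A^T A + W] being definite forces [x = 0]. *)
Lemma newton_direction_exists (mu : R) (v : 'cV[R]_m) :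
  pos_definite (A^T *m A + W) -> 0 < mu ->
  exists d, is_newton_direction A b c W v mu d.
Proof.
move=> AW mu0; set k := Num.sqrt mu.
have k0 : k != 0 by rewrite gt_eqF ?sqrtr_gt0.
pose D : 'cV[R]_m -> 'cV[R]_m := fun y => \col_i (expR (v i 0) ^+ 2 * y i 0).
pose E := diag_mx (\row_i expR (v i 0) ^+ 2).
have DE y : E *m y = D y by apply/colP => i; rewrite mul_diag_mx !mxE.
have unitM : W + A^T *m E *m A \in unitmx.
  apply: unitmx_inj => x; rewrite mulmxDl -!mulmxA DE => /(congr1 (dotv x)).
  rewrite dotvDr dotv_trmx [RHS]/dotv mulmx0 mxE => h.
  have dD y : dotv y (D y) =
      dotv (\col_i (expR (v i 0) * y i 0)) (\col_i (expR (v i 0) * y i 0)).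
    by rewrite !dotvE; apply: eq_bigr => i _; rewrite !mxE; ring.
  have := W_psd.2 x; have := dotvv_ge0 (\col_i (expR (v i 0) * (A *m x) i 0)).
  rewrite -dD => h1 h2.
  have /dotvv_eq0 Ax0 : dotv (\col_i (expR (v i 0) * (A *m x) i 0))
      (\col_i (expR (v i 0) * (A *m x) i 0)) = 0 by rewrite -dD; lra.
  have Wx0 : dotv x (W *m x) = 0 by lra.
  have {}Ax0 : A *m x = 0.
    apply/colP => i; move/colP/(_ i): Ax0; rewrite !mxE => /eqP.
    by rewrite mulf_eq0 gt_eqF ?expR_gt0// => /eqP.
  have [//|/AW.2] := eqVneq x 0.
  by rewrite mulmxDl dotvDr -mulmxA dotv_trmx Ax0 [dotv 0 0]/dotv
    mulmx0 mxE add0r Wx0 ltxx.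
pose rhs := 2 * k *: (A^T *m vexp v) - A^T *m D b - c.
pose x := invmx (W + A^T *m E *m A) *m rhs.
have Mx : W *m x + A^T *m D (A *m x) = rhs.
  by rewrite -DE mulmxA mulmxA -mulmxDl /x mulKVmx.
exists (\col_i (1 - expR (v i 0) * (A *m x + b) i 0 / k)), x; split.
- have -> : W *m x = rhs - A^T *m D (A *m x) by rewrite -Mx addrK.
  have -> : rhs - A^T *m D (A *m x) + c =
      A^T *m (2 * k *: vexp v - D b - D (A *m x)).
    by rewrite /rhs !mulmxBr scalemxAr addrAC subrK.
  rewrite scalemxAr; congr (_ *m _).
  move: (A *m x) => y.
  by apply/colP => i; rewrite !mxE -/k; field.
- apply/colP => i; rewrite !mxE expRN -/k; field.
  by rewrite k0 gt_eqF ?expR_gt0.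
Qed.

(** Subtracting the two systems, with [D = xv - xu], gives [k A^T p = W D] and [k q = A D], hence
    [k^2 <q, p> = <D, W D> >= 0]. *)
Lemma divergence_newton_le (mu : R) (u v d : 'cV[R]_m) : 0 < mu ->
  is_centered A b c W mu u -> is_newton_direction A b c W v mu d ->
  divergence u v <= 2^-1 -> divergence u (v + d) <= divergence u v ^+ 2.
Proof.
move=> mu0 [xu [cu1 cu2]] [xv [nv1 nv2]].
set k := Num.sqrt mu in cu1 cu2 nv1 nv2.
have k0 : 0 < k by rewrite sqrtr_gt0.
pose p := vexp v + hadamard (vexp v) d - vexp u.
pose q := vexp (- v) - hadamard (vexp (- v)) d - vexp (- u).
have pE : k *: (A^T *m p) = W *m (xv - xu).
  by rewrite /p mulmxBr scalerBr nv1 cu1 opprD addrACA subrr addr0 mulmxBr.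
have qE : k *: q = A *m (xv - xu).
  by rewrite /q scalerBr nv2 cu2 opprD addrACA subrr addr0 mulmxBr.
have qp : 0 <= dotv q p.
  have := W_psd.2 (xv - xu).
  by rewrite -pE dotvZr dotv_trmx -qE dotvZl !pmulr_rge0.
rewrite !divergenceE => hs.
have -> : \sum_i (expR ((v + d) i 0 - u i 0)
      + expR (- ((v + d) i 0 - u i 0)) - 2) =
    \sum_i (expR (v i 0 - u i 0 + d i 0)
      + expR (- (v i 0 - u i 0 + d i 0)) - 2).
  by apply: eq_bigr => i _; rewrite mxE addrAC.
apply: newton_step_contraction hs.
(* With [s = v - u], [- q_i p_i] is the summand [d_i^2 + 2 d_i sinh s_i + g_i]. *)
rewrite -oppr_ge0 -sumrN; congr (0 <= _) : qp; rewrite dotvE.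
apply: eq_bigr => i _; rewrite !mxE opprB !expRB !expRN; field.
by rewrite !gt_eqF ?expR_gt0.
Qed.

End Newton.

(** * Norm, continuity and logarithm estimates for the barrier *)

Lemma ler_coord_mx_norm {R : realType} {m n : nat} (x : 'M[R]_(m, n)) i j :
  `|x i j| <= `|x|.
Proof.
rewrite [leRHS]/Num.Def.normr /= mx_normrE.
by apply/bigmax_geP; right; exists (i, j).
Qed.

Lemma mx_entry_bound {R : realType} {m n : nat} (A : 'M[R]_(m, n)) :
  exists2 K, 0 < K & forall (x : 'cV[R]_n) i, `|(A *m x) i 0| <= K * `|x|.
Proof.
pose S i := \sum_j `|A i j|; have S0 i : 0 <= S i by exact: sumr_ge0.
(* The [+ 1] keeps the constant positive even when [A] is zero. *)
exists (\sum_i S i + 1); first by rewrite ltr_wpDl ?sumr_ge0.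
move=> x i; rewrite mxE (le_trans (ler_norm_sum _ _ _))//.
apply: (@le_trans _ _ (S i * `|x|)).
  rewrite mulr_suml ler_sum// => j _.
  by rewrite normrM ler_wpM2l// ler_coord_mx_norm.
by rewrite ler_wpM2r// (le_trans (ler_term_sum S i S0))// lerDl.
Qed.

Lemma sum_continuous_at {R : realType} {T : topologicalType} {I : finType}
    (F : I -> T -> R) (x : T) :
  (forall i, F i y @[y --> x] --> F i x) ->
  (\sum_i F i y) @[y --> x] --> \sum_i F i x.
Proof. 
move=> h.
apply: (@cvg_big R^o I +%R 0 xpredT (@add_continuous R^o)
  T (nbhs x) _ F (F^~ x)) => i _.
exact: h.
Qed.

Lemma ln_le_tangent {R : realType} (T y : R) :
  0 < T -> 0 < y -> ln y <= ln T + y / T - 1.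
Proof.
move=> T0 y0; have yT0 : 0 < y / T by rewrite divr_gt0.
have -> : ln y = ln T + ln (1 + (y / T - 1)).
  by rewrite [1 + _]addrC subrK ln_div ?posrE// addrC subrK.
by rewrite -addrA lerD2l le_ln1Dx// ltrBrDl subrr.
Qed.

(** [ln (1 + z) = - ln (1/(1 + z)) >= 1 - 1/(1 + z) = z - z^2/(1 + z)], and [1/(1 + z) <= 2] for
    [z >= -1/2]. *)
Lemma ln_add_ge {R : realType} (y a : R) : 0 < y -> `|a / y| <= 2^-1 ->
  ln y + a / y - 2 * (a / y) ^+ 2 <= ln (y + a).
Proof.
move=> y0; set z := a / y; rewrite ler_norml => /andP[z1 z2].
have z0 : 0 < 1 + z by lra.
have -> : ln (y + a) = ln y - ln (1 + z)^-1.
  rewrite lnV ?posrE// opprK -lnM ?posrE//; congr ln.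
  by rewrite /z; field; rewrite gt_eqF.
have := @le_ln1Dx _ ((1 + z)^-1 - 1).
rewrite [1 + (_ - _)]addrC subrK ltrBrDl subrr invr_gt0 => /(_ z0).
have -> : (1 + z)^-1 - 1 = - z + z ^+ 2 * (1 + z)^-1 by field; rewrite gt_eqF.
have : z ^+ 2 * (1 + z)^-1 <= z ^+ 2 * 2.
  by rewrite ler_wpM2l ?sqr_ge0// invf_ple ?posrE//; lra.
lra.
Qed.

(** Points are transposed row vectors here, the form in which [rV_compact] gives compact boxes. *)
Lemma mulmx_coord_continuous {R : realType} {k n} (M : 'M[R]_(k, n)) i :
  continuous (fun v : 'rV[R]_n => (M *m v^T) i 0).
Proof.
move=> v; rewrite [X in continuous_at _ X](_ : _ =
    fun v : 'rV[R]_n => \sum_j M i j * v 0 j); last first.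
  by apply/funext => w; rewrite mxE; apply: eq_bigr => j _; rewrite mxE.
apply: (sum_continuous_at (fun j (w : 'rV[R]_n) => M i j * w 0 j)) => j.
apply: (@cvgM _ 'rV[R]_n (nbhs v) _ (fun=> M i j) (fun w => w 0 j)).
  exact: cvg_cst.
exact: coord_continuous.
Qed.

(** * Existence of a centered point by minimizing the log barrier *)

Section Barrier.
Context {R : realType} {m n : nat} (A : 'M[R]_(m, n)) (b : 'cV[R]_m)
  (c : 'cV[R]_n) (W : 'M[R]_n) (mu : R).
Hypothesis W_psd : pos_semidefinite W.
Hypothesis bounded_sublevel :
  forall gamma : R, bounded_set (sublevel A b c W gamma).
Hypothesis mu_gt0 : 0 < mu.

Definition objective (x : 'cV[R]_n) := 2^-1 * dotv x (W *m x) + dotv c x.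
Definition slack (x : 'cV[R]_n) i := (A *m x + b) i 0.
Definition barrier x := objective x - mu * \sum_i ln (slack x i).

Lemma objective_add (x h : 'cV[R]_n) (t : R) :
  objective (x + t *: h) =
    objective x + t * dotv (W *m x + c) h + t ^+ 2 / 2 * dotv h (W *m h).
Proof.
have Wsym : dotv x (W *m h) = dotv (W *m x) h.
  by rewrite -{1}W_psd.1 dotv_trmx.
rewrite /objective mulmxDr -scalemxAr !(dotvDl, dotvDr, dotvZl, dotvZr).
by rewrite Wsym (dotvC h (W *m x)); field.
Qed.

Lemma slack_add x h t i : slack (x + t *: h) i = slack x i + t * (A *m h) i 0.
Proof. by rewrite /slack mulmxDr -scalemxAr !mxE addrAC. Qed.

(** A far feasible [x] is pulled back along its segment to [z], at distance [r] from [x0]. There [z]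
    is feasible but outside the sublevel set at [objective x0 + 1], and convexity carries the gain
    of 1 over the distance [r] out to [x]. *)
Lemma objective_linear_growth x0 : strictly_feasible A b x0 ->
  exists2 r, 0 < r & forall x, (forall i, 0 <= slack x i) -> r <= `|x - x0| ->
    objective x0 + `|x - x0| / r <= objective x.
Proof.
move=> fx0.
have [M M0 hM] := ex_strict_bound_gt0 (bounded_sublevel (objective x0 + 1)).
have r0 : 0 < M + `|x0| by rewrite ltr_pwDl.
exists (M + `|x0|) => // x fx; set r := M + _; set rho := `|_| => rrho.
have rho0 : 0 < rho by apply: lt_le_trans rrho.
pose l := r / rho.
have l0 : 0 < l by rewrite divr_gt0.
have l1 : l <= 1 by rewrite ler_pdivrMr// mul1r.
pose z := x0 + l *: (x - x0).
have sz i : 0 <= slack z i.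
  have := fx i; have := fx0 i; rewrite -/(slack x0 i).
  have -> : slack x i = slack x0 i + 1 * (A *m (x - x0)) i 0.
    by rewrite -slack_add scale1r addrC subrK.
  by rewrite /z slack_add mul1r; nra.
have qz : objective x0 + 1 < objective z.
  rewrite ltNge; apply/negP => qz.
  have /hM/= : sublevel A b c W (objective x0 + 1) z by split.
  apply/negP; rewrite -leNgt.
  have : `|l *: (x - x0)| <= `|z| + `|x0|.
    have -> : l *: (x - x0) = z - x0 by rewrite /z addrAC subrr add0r.
    exact: ler_normB.
  rewrite normrZ gtr0_norm// -/rho /l mulfVK ?gt_eqF// /r.
  by rewrite lerD2r.
have : objective x = objective x0 + 1 * dotv (W *m x0 + c) (x - x0) +
    1 ^+ 2 / 2 * dotv (x - x0) (W *m (x - x0)).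
  by rewrite -objective_add scale1r addrC subrK.
move: qz; rewrite /z objective_add => qz qx.
have d0 := W_psd.2 (x - x0).
have lq : 1 <= l * (objective x - objective x0).
  rewrite qx; move: d0 qz; set d := dotv _ (W *m (_ - _)); set g := dotv _ _.
  (* This is convexity: [l <= 1] makes the quadratic term along the segment at most its linear
     interpolation. *)
  move=> d0 qz; have : l ^+ 2 * d <= l * d.
    by rewrite expr2 ler_wpM2r// ler_piMl// ltW.
  lra.
have -> : rho / r = l^-1 by rewrite /l invf_div.
rewrite -lerBrDl -div1r ler_pdivrMr// mulrC.
exact: lq.
Qed.

Lemma slack_le_norm x0 : exists2 K, 0 < K &
  forall x i, slack x i <= slack x0 i + K * `|x - x0|.
Proof.
have [K K0 hK] := mx_entry_bound A; exists K => // x i.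
have -> : slack x i = slack x0 i + 1 * (A *m (x - x0)) i 0.
  by rewrite -slack_add scale1r addrC subrK.
by rewrite mul1r lerD2l (le_trans (ler_norm _)).
Qed.

(** The convex objective lies above its tangent at [x0]. *)
Lemma objective_ge_norm x0 : exists2 G, 0 < G &
  forall x, objective x0 - G * `|x - x0| <= objective x.
Proof.
have [G G0 hG] := mx_entry_bound (W *m x0 + c)^T; exists G => // x.
have -> : objective x = objective x0 + 1 * dotv (W *m x0 + c) (x - x0) +
    1 ^+ 2 / 2 * dotv (x - x0) (W *m (x - x0)).
  by rewrite -objective_add scale1r addrC subrK.
have := W_psd.2 (x - x0); have := hG (x - x0) 0.
by rewrite -/(dotv _ _) ler_norml => /andP[+ _]; lra.
Qed.

Lemma barrier_sublevel_bounded x0 : strictly_feasible A b x0 ->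
  exists P, forall x, strictly_feasible A b x -> barrier x <= barrier x0 ->
    `|x - x0| <= P.
Proof.
move=> fx0; have [r r0 hr] := objective_linear_growth x0 fx0.
have [K K0 hK] := slack_le_norm x0.
(* Tangents of [ln] at a [T] this large bound the logarithmic part by a linear
   function of slope at most [1 / (2 r)], half the growth of the objective. *)
pose T := 2 * mu * m%:R * K * r + 1.
have mKr0 : 0 <= mu * m%:R * K * r by rewrite !mulr_ge0// ltW.
have T0 : 0 < T by rewrite /T; lra.
pose B := barrier x0 - objective x0 +
  mu * \sum_(i < m) (ln T + slack x0 i / T - 1).
(* Beyond [r], the growth [rho / r] less the logarithmic share [rho / (2 r)] is at most the constant
   [B]. *)
exists (Num.max r (2 * r * B)) => x fx bx.
rewrite le_max; have [//|rx] := leP `|x - x0| r; rewrite /=.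
have := hr x (fun i => ltW (fx i)) (ltW rx).
have : \sum_i ln (slack x i) <=
    \sum_(i < m) (ln T + slack x0 i / T - 1) + m%:R * (K * `|x - x0| / T).
  rewrite -[X in X%:R]card_ord mulr_natl -sumr_const -big_split.
  rewrite ler_sum// => i _.
  rewrite (le_trans (ln_le_tangent _ _ T0 (fx i)))// -/(slack x i).
  have : slack x i / T <= (slack x0 i + K * `|x - x0|) / T.
    by rewrite ler_pM2r ?invr_gt0.
  by rewrite mulrDl /=; lra.
move: bx rx; rewrite {1}/barrier.
set rho := `|_|; set L := \sum_i _; set L' := \sum_(_ < _) _ => bx rx hL hq.
have rho0 : 0 < rho by apply: lt_trans rx.
have h1 : mu * (m%:R * (K * rho / T)) <= rho / r / 2.
  rewrite [X in _ <= X](_ : _ = rho / (2 * r)); last by field; rewrite gt_eqF.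
  rewrite ler_pdivlMr ?mulr_gt0//.
  have -> : mu * (m%:R * (K * rho / T)) * (2 * r) =
    rho * ((T - 1) / T) by rewrite /T; field; rewrite gt_eqF.
  apply: ler_piMr; first exact: ltW.
  by rewrite ler_pdivrMr// mul1r gerBl.
have h2 : mu * L <= mu * L' + mu * (m%:R * (K * rho / T)).
  by rewrite -mulrDr ler_pM2l.
have : rho / r / 2 <= B.
  rewrite /B -/L'; lra.
have -> : rho / r / 2 = rho / (2 * r) by field; rewrite gt_eqF.
by rewrite ler_pdivrMr ?mulr_gt0// mulrC.
Qed.

(** On a bounded set the objective is bounded below and every logarithm above, so a bounded barrier
    keeps each single logarithm bounded below; [eps] is the exponential of that bound. *)
Lemma barrier_sublevel_slack x0 P : strictly_feasible A b x0 ->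
  exists2 eps, 0 < eps & forall x, strictly_feasible A b x ->
    `|x - x0| <= P -> barrier x <= barrier x0 -> forall i, eps <= slack x i.
Proof.
move=> fx0; have [G G0 hG] := objective_ge_norm x0.
have [K K0 hK] := slack_le_norm x0.
pose U i := slack x0 i + K * P.
exists (expR ((objective x0 - G * P - barrier x0) / mu - \sum_i `|U i|)).
  exact: expR_gt0.
move=> x fx xP bx i.
rewrite -[leRHS]lnK ?posrE ?fx// ler_expR.
have : \sum_i ln (slack x i) <= ln (slack x i) + \sum_i `|U i|.
  rewrite (bigD1 i)//= lerD2l [leRHS](bigD1 i)//=.
  rewrite -[leLHS]add0r lerD// ler_sum// => j _.
  rewrite (le_trans (ltW (ln_sublinear (fx j))))// (le_trans _ (ler_norm _))//.
  by rewrite (le_trans (hK x j))// lerD2l ler_pM2l.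
have := hG x; have : G * `|x - x0| <= G * P by rewrite ler_pM2l.
move: bx; rewrite {1}/barrier.
set L := \sum_i ln _; set V := \sum_i `|U i| => bx h1 h2 h3.
rewrite lerBlDr (le_trans _ h3)// ler_pdivrMr// mulrC; lra.
Qed.

Lemma slack_continuous i : continuous (fun v : 'rV[R]_n => slack v^T i).
Proof.
move=> v; rewrite /slack [X in continuous_at _ X](_ : _ =
    fun v : 'rV[R]_n => (A *m v^T) i 0 + b i 0); last first.
  by apply/funext => w; rewrite mxE.
apply: (@cvgD _ _ 'rV[R]_n (nbhs v) _ (fun w => (A *m w^T) i 0) (fun=> b i 0)).
  exact: mulmx_coord_continuous.
exact: cvg_cst.
Qed.

Lemma objective_continuous : continuous (fun v : 'rV[R]_n => objective v^T).
Proof.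
move=> v; rewrite /objective.
apply: (@cvgD _ _ 'rV[R]_n (nbhs v) _
  (fun w => 2^-1 * dotv w^T (W *m w^T)) (fun w => dotv c w^T)); last first.
  exact: mulmx_coord_continuous.
apply: (@cvgM _ 'rV[R]_n (nbhs v) _
  (fun=> 2^-1) (fun w => dotv w^T (W *m w^T))).
  exact: cvg_cst.
rewrite [X in X @ _](_ : _ =
  fun w : 'rV[R]_n => \sum_i w 0 i * (W *m w^T) i 0); last first.
  by apply/funext => w; rewrite dotvE; apply: eq_bigr => i _; rewrite mxE.
rewrite dotvE; under eq_bigr do rewrite mxE.
apply: (sum_continuous_at
  (fun i (w : 'rV[R]_n) => w 0 i * (W *m w^T) i 0)) => i.
apply: (@cvgM _ 'rV[R]_n (nbhs v) _ (fun w => w 0 i)).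
  exact: coord_continuous.
exact: mulmx_coord_continuous.
Qed.

Lemma barrier_minimizer x0 : strictly_feasible A b x0 ->
  exists2 x, strictly_feasible A b x &
    forall y, strictly_feasible A b y -> barrier x <= barrier y.
Proof.
move=> fx0; have [P hP] := barrier_sublevel_bounded _ fx0.
have [eps eps0 heps] := barrier_sublevel_slack _ P fx0.
pose Q := `|x0| + P.
pose box := [set v : 'rV[R]_n | forall j, `[- Q, Q]%classic (v 0 j)].
(* The bound [eps] in place of strict positivity makes [K] closed and keeps [ln] continuous on it.
   [K] contains all strictly feasible points with barrier at most that of [x0], so a minimum over
   [K] is global. *)
pose K := box `&` \bigcap_(i in setT) [set v : 'rV[R]_n | eps <= slack v^T i].
have Kc : compact K.
  apply: compact_closedI.
    by apply: (@rV_compact _ _ (fun=> `[- Q, Q]%classic)) => j;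
      exact: segment_compact.
  apply: closed_bigI => i _.
  apply: (closed_comp (f := fun v : 'rV[R]_n => slack v^T i)
    (D := [set y | eps <= y])).
    by move=> v _; exact: slack_continuous.
  exact: closed_ge.
have Kf v : K v -> strictly_feasible A b v^T.
  by move=> [_ h] i; apply: lt_le_trans eps0 (h i I).
have sub x : strictly_feasible A b x -> barrier x <= barrier x0 -> K x^T.
  move=> fx bx; split; last first.
    by move=> i _; rewrite /= trmxK; exact: (heps _ fx (hP _ fx bx) bx).
  move=> j; rewrite /= in_itv/= -ler_norml mxE.
  rewrite (le_trans (ler_coord_mx_norm x j 0))//.
  rewrite /Q -[x in `|x|](subrK x0) addrC.
  by rewrite (le_trans (ler_normD _ _))// lerD2l hP.
have Kcont : {within K, continuous (fun v => barrier v^T)}.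
  apply: continuous_in_subspaceT => v /set_mem Kv; rewrite /barrier.
  apply: (@cvgB _ _ 'rV[R]_n (nbhs v) _ (fun w => objective w^T)
    (fun w => mu * \sum_i ln (slack w^T i))); first exact: objective_continuous.
  apply: (@cvgM _ 'rV[R]_n (nbhs v) _ (fun=> mu)
    (fun w => \sum_i ln (slack w^T i))); first exact: cvg_cst.
  apply: (sum_continuous_at (fun i (w : 'rV[R]_n) => ln (slack w^T i))) => i.
  apply: (@continuous_comp _ _ _ (fun w : 'rV[R]_n => slack w^T i) (@ln R)).
    exact: slack_continuous.
  exact/continuous_ln/Kf.
have Kx0 := sub _ fx0 (lexx _).
have [v /set_mem Kv vmin] := compact_EVT_min (ex_intro _ _ Kx0) Kc Kcont.
exists v^T; first exact: Kf.
move=> y fy; have [by0|/ltW by0] := leP (barrier y) (barrier x0).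
  by have := vmin _ (mem_set (sub _ fy by0)); rewrite trmxK.
by apply: le_trans by0; have := vmin _ (mem_set Kx0); rewrite trmxK.
Qed.
Lemma barrier_stationary x : strictly_feasible A b x ->
  (forall y, strictly_feasible A b y -> barrier x <= barrier y) ->
  W *m x + c = mu *: (A^T *m \col_i (slack x i)^-1).
Proof.
move=> fx xmin; pose w : 'cV[R]_m := \col_i (slack x i)^-1.
pose h := W *m x + c - mu *: (A^T *m w).
suff : dotv h h <= 0.
  move=> h0; apply/eqP; rewrite -subr_eq0; apply/eqP/dotvv_eq0/eqP.
  by rewrite eq_le h0 dotvv_ge0.
(* [h] is the gradient: a step [- t h] changes the barrier by at most
   [- t G + t^2 C], which is negative for the [t] below. *)
rewrite leNgt; apply/negP => G0; set G := dotv h h in G0.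
pose z i := (A *m h) i 0 / slack x i.
pose S := 1 + \sum_i `|z i|.
have zS i : `|z i| <= S.
  have := ler_term_sum (fun i => `|z i|) i (fun=> normr_ge0 _).
  by move=> /le_trans; apply; rewrite lerDr.
have S1 : 1 <= S by rewrite lerDl sumr_ge0.
have zE : \sum_i z i = dotv (A^T *m w) h.
  rewrite dotvC dotv_trmx dotvE; apply: eq_bigr => i _.
  by rewrite [w _ _]mxE.
pose C := 2^-1 * dotv h (W *m h) + mu * (2 * \sum_i z i ^+ 2).
have C0 : 0 <= C.
  have h0 := W_psd.2 h; have m0 := ltW mu_gt0.
  apply: addr_ge0; first by rewrite mulr_ge0.
  by rewrite !mulr_ge0 ?sumr_ge0// => i _; rewrite sqr_ge0.
(* The first summand gives [t S <= 1/2], so the step stays strictly feasible and [ln_add_ge]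
   applies; together they give [t C < G], so the barrier decreases. *)
pose t := (2 * S + 2 * C / G)^-1.
have tV0 : 0 < 2 * S + 2 * C / G.
  by rewrite ltr_pwDl ?divr_ge0 ?mulr_ge0 ?(ltW G0)//; lra.
have t0 : 0 < t by rewrite invr_gt0.
have tS : t * S <= 2^-1.
  rewrite mulrC ler_pdivrMr//; have : 0 <= 2 * C / G.
    by rewrite divr_ge0 ?mulr_ge0 ?(ltW G0).
  lra.
have tz i : `|- t * (A *m h) i 0 / slack x i| <= 2^-1.
  rewrite -mulrA normrM normrN (gtr0_norm t0) (le_trans _ tS)// ler_pM2l//.
  exact: zS.
have sE i : slack (x + - t *: h) i = slack x i + - t * (A *m h) i 0.
  by exact: slack_add.
have fy : strictly_feasible A b (x + - t *: h).
  move=> i; rewrite -/(slack _ i) sE.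
  have -> : slack x i + - t * (A *m h) i 0 =
      slack x i * (1 + - t * (A *m h) i 0 / slack x i).
    by field; apply: lt0r_neq0; exact: fx.
  rewrite mulr_gt0 ?fx//; have := tz i; rewrite ler_norml => /andP[+ _]; lra.
have := xmin _ fy; apply/negP; rewrite -ltNge /barrier objective_add.
have : \sum_i ln (slack x i) - t * (\sum_i z i) - t ^+ 2 * (2 * \sum_i z i ^+ 2)
    <= \sum_i ln (slack (x + - t *: h) i).
  rewrite -!mulNr !mulr_sumr -!big_split/= ler_sum// => i _.
  rewrite sE (le_trans _ (ln_add_ge _ _ (fx i) (tz i)))// -/(slack x i) /z.
  by rewrite le_eqVlt; apply/orP; left; apply/eqP; ring.
have GE : G = dotv (W *m x + c) h - mu * \sum_i z i.
  by rewrite zE /G {1}/h -scaleNr dotvDl dotvZl mulNr.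
have tC : t * C < G.
  rewrite mulrC ltr_pdivrMr// mulrDr mulrCA.
  have -> : G * (2 * C / G) = 2 * C by field; rewrite gt_eqF.
  have : 0 < G * S by rewrite mulr_gt0//; lra.
  lra.
set L := \sum_i _; set L' := \sum_i ln (slack (_ + _) i) => hL.
have : mu * (L - t * (\sum_i z i) - t ^+ 2 * (2 * \sum_i z i ^+ 2)) <= mu * L'.
  by rewrite ler_pM2l.
have : t * (t * C) < t * G by rewrite ltr_pM2l.
rewrite GE /C sqrrN; lra.
Qed.

(** The second centrality equation dictates [v]; then [sqrt mu e^v = mu / slack], and the first
    equation is stationarity of the barrier. *)
Lemma centered_point_exists (x0 : 'cV[R]_n) : strictly_feasible A b x0 ->
  exists u, is_centered A b c W mu u.
Proof.
move=> /barrier_minimizer[x fx xmin].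
have k0 : 0 < Num.sqrt mu by rewrite sqrtr_gt0.
exists (\col_i (- ln (slack x i / Num.sqrt mu))), x.
have e0 i : 0 < slack x i / Num.sqrt mu by rewrite divr_gt0 ?fx.
split.
- rewrite barrier_stationary// -[in RHS](sqr_sqrtr (ltW mu_gt0)) expr2 -scalerA.
  congr (_ *: _); rewrite scalemxAr; congr (_ *m _).
  by apply/colP => i; rewrite !mxE expRN lnK ?posrE// invf_div.
- apply/colP => i; rewrite !mxE opprK lnK ?posrE// mulrC.
  by rewrite divfK ?gt_eqF// /slack !mxE.
Qed.
End Barrier.

(** * Induction on the one-step bound *)

Theorem theorem2p4 (R : realType) (m n : nat) (A : 'M[R]_(m, n))
    (b : 'cV[R]_m) (c : 'cV[R]_n) (W : 'M[R]_n)
    (W_psd : pos_semidefinite W)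
    (strict_feas : exists x : 'cV[R]_n, strictly_feasible A b x)
    (bounded_sublevel : forall gamma : R, bounded_set (sublevel A b c W gamma))
    (AW_pd : pos_definite (A^T *m A + W))
    (mu : R) (mu_gt0 : 0 < mu) (theta : R) (v : nat -> 'cV[R]_m)
    (v_step : forall i : nat, v i.+1 = v i + newton_direction A b c W (v i) mu)
    (v0_theta : centered_divergence A b c W mu (v 0%N) <= theta)
    (theta_le : theta <= 2^-1) :
  forall i : nat, centered_divergence A b c W mu (v i) <= theta ^+ (2 ^ i)%N.
Proof.
have [x0 fx0] := strict_feas.
(* [getPex] turns existence into the defining property of the chosen point. *)
have /getPex hu :=
  centered_point_exists A b c W mu W_psd bounded_sublevel mu_gt0 x0 fx0.
have theta0 : 0 <= theta by apply: le_trans v0_theta; exact: divergence_ge0.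
have theta1 : theta <= 1 by lra.
elim=> [|i IHi]; first by rewrite expn0 expr1.
have /getPex hd := newton_direction_exists A b c W W_psd mu (v i) AW_pd mu_gt0.
(* [theta ^+ (2 ^ i) <= theta] since [0 <= theta <= 1], so the one-step bound applies to every
   iterate. *)
have hi : centered_divergence A b c W mu (v i) <= 2^-1.
  apply: (le_trans IHi); apply: le_trans theta_le.
  by rewrite -[leRHS]expr1 ler_wiXn2l// expn_gt0.
have := divergence_newton_le A b c W W_psd _ _ _ _ mu_gt0 hu hd hi.
rewrite v_step => /le_trans; apply.
by rewrite expnS mulnC exprM lerXn2r ?nnegrE ?divergence_ge0 ?exprn_ge0.
Qed.
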